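(* Let $\tilde Z$ be obtained from $Z=(X,Y)$ by the block-transformation. Assume that the block-transformation satisfies the following condition: there exist constants $\alpha>0$ and $\epsilon_o>0$, not depending on $n$, such that for all sufficiently large $n$ $$P\big(E[L(\tilde Z)-L(Z)\mid Z]\ge\epsilon_o\big)\ge 1-\exp[-n^{\alpha}].$$ Then there exist a constant $b>0$ not depending on $n$ and $n_6<\infty$ such that for every $n>n_6$ $$\mathrm{Var}[L(Z)]\ge b\, n.$$
   Context: 3-multinomial block model: fix an integer $l\ge2$ and $q_1,q_2,q_3\in(0,1)$ with $q_1+q_2+q_3=1$. Let $(W_k)_{k\ge1}$ be i.i.d. with $P(W_k=l-1)=q_1$, $P(W_k=l)=q_2$, $P(W_k=l+1)=q_3$, and let $\vartheta$ be uniform on $\{0,1\}$, independent of $(W_k)$. Build an infinite binary sequence by concatenating a run of $W_1$ symbols $\vartheta$, then a run of $W_2$ symbols $1-\vartheta$, then a run of $W_3$ symbols $\vartheta$, and so on with alternating symbols. $X=X_1\cdots X_n$ is the string of its first $n$ symbols; $Y=Y_1\cdots Y_n$ is an independent copy of $X$; $Z:=(X,Y)$. For a binary string $x$ of length $n$, a block of $x$ is a maximal run of equal symbols, except that the last run (the one ending at position $n$) is not counted as a block. $L(Z)$ is the length of the longest common subsequence of $X$ and $Y$. Block-transformation: given $z=(x,y)$, choose uniformly at random one of the blocks of $x$ of length $l-1$ and, independently, uniformly at random one of the blocks of $x$ of length $l+1$; change both of them into blocks of length $l$ (keeping the symbols and the order of all runs); $y$ is left unchanged. The randomness is independent of $Z$.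 As a convention, if $x$ has no block of length $l-1$ or no block of length $l+1$, then $z$ is left unchanged. *)

(* Defs.v *)
From HB Require Import structures.
From mathcomp Require Import all_boot all_order all_algebra.
From mathcomp Require Import all_classical all_reals all_analysis.

Set Implicit Arguments.
Unset Strict Implicit.
Unset Printing Implicit Defensive.

Import Order.TTheory GRing.Theory Num.Theory.
Import numFieldNormedType.Exports.

Local Open Scope classical_set_scope.
Local Open Scope ring_scope.

(* Run-length encoding: the maximal runs of x, in order, as (symbol, length). *)
Fixpoint runs (x : seq bool) : seq (bool * nat) :=
  if x is b :: x' then
    if runs x' is (c, k) :: r then
      if c == b then (b, k.+1) :: r else (b, 1%N) :: (c, k) :: r
    else [:: (b, 1%N)]
  else [::].

Definition unruns (r : seq (bool * nat)) : seq bool :=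
  flatten [seq nseq p.2 p.1 | p <- r].

Definition run_length (r : seq (bool * nat)) (i : nat) : nat :=
  (nth (false, 0%N) r i).2.

Definition set_run_length (r : seq (bool * nat)) (i k : nat) :
    seq (bool * nat) :=
  set_nth (false, 0%N) r i ((nth (false, 0%N) r i).1, k).

(* The positions, in the list of runs of x, of the blocks of length k; the
   predecessor discards the last run, which is not a block. *)
Definition blocks (k : nat) (x : seq bool) : seq nat :=
  [seq i <- iota 0 (size (runs x)).-1 | run_length (runs x) i == k].

Definition has_both_blocks (l : nat) (x : seq bool) : bool :=
  (blocks l.-1 x != [::]) && (blocks l.+1 x != [::]).

(* Meaningful for i in blocks l.-1 x and j in blocks l.+1 x. *)
Definition block_transform (l : nat) (x : seq bool) (i j : nat) : seq bool :=
  if has_both_blocks l x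
  then unruns (set_run_length (set_run_length (runs x) i l) j l)
  else x.

Definition common_subseq (x y s : seq bool) : bool := subseq s x && subseq s y.

Definition lcs (x y : seq bool) : nat :=
  \max_(k < (size x).+1 | [exists s : k.-tuple bool, common_subseq x y s]) k.

(* Symbol number t (from 0) of the concatenation of a run of w 0 symbols th, a
   run of w 1 symbols ~~ th, etc. When all w k are positive, the first t.+1 runs
   reach position t; the default value of nth is then never used. *)
Definition run_symbol (th : bool) (w : nat -> nat) (t : nat) : bool :=
  nth false (unruns (mkseq (fun k => (th (+) odd k, w k)) t.+1)) t.

Definition run_string (th : bool) (w : nat -> nat) (n : nat) : n.-tuple bool :=
  [tuple run_symbol th w i | i < n].

Section probability.
Context {d : measure_display} {T : measurableType d} {R : realType}.
Variable P : probability T R.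

Definition mutually_independent (I : eqType) (E : I -> set_system T) : Prop :=
  forall (s : seq I) (A : I -> set T), uniq s ->
    (forall i, i \in s -> E i (A i)) ->
    P (\bigcap_(i in [set` s]) A i) = (\prod_(i <- s) P (A i))%E.

(* The sigma-algebra of events generated by a random variable. *)
Definition events_of d' (T' : measurableType d') (X : T -> T') : set_system T :=
  preimage_set_system setT X measurable.

(* W 0, W 1, ... are the successive run lengths and th is the first symbol;
   index None stands for th and Some k for W k. *)
Record multinomial_blocks (l : nat) (q1 q2 q3 : R)
    (th : {RV P >-> bool}) (W : nat -> {RV P >-> nat}) : Prop := {
  blocks_indep : mutually_independent (fun i : option nat =>
    if i is Some k then events_of (W k) else events_of th);
  first_symbol_unif : forall b, P (th @^-1` [set b]) = (2^-1)%:E;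
  block_law1 : forall k, P (W k @^-1` [set l.-1]) = q1%:E;
  block_law2 : forall k, P (W k @^-1` [set l]) = q2%:E;
  block_law3 : forall k, P (W k @^-1` [set l.+1]) = q3%:E
}.

Definition independent_copy d' (T' : measurableType d') (X Y : T -> T') : Prop :=
  (forall A, measurable A -> P (Y @^-1` A) = P (X @^-1` A)) /\
  (forall A B, measurable A -> measurable B ->
    P (X @^-1` A `&` Y @^-1` B) = (P (X @^-1` A) * P (Y @^-1` B))%E).

(* Given (X, Y) = (x, y), where x has blocks of both lengths l.-1 and l.+1, the
   pair (I, J) is uniform on blocks l.-1 x * blocks l.+1 x: the two choices are
   uniform, independent of each other, and use no other information on (X, Y).
   If one kind of block is missing, I and J are irrelevant. *)
Definition uniform_block_choice (l n : nat) (X Y : T -> n.-tuple bool)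
    (I J : {RV P >-> nat}) : Prop :=
  forall (x y : n.-tuple bool) (i j : nat),
    i \in blocks l.-1 x -> j \in blocks l.+1 x ->
    P [set w | [/\ X w = x, Y w = y, I w = i & J w = j]] =
    (P [set w | X w = x /\ Y w = y] *
     ((size (blocks l.-1 x))%:R^-1 * (size (blocks l.+1 x))%:R^-1)%:E)%E.

(* E[f | Z] for Z with finitely many values: on the event Z = z it is the mean
   of f over that event. *)
Definition cond_expectation (S : Type) (f : T -> R) (Z : T -> S) (w : T) : R :=
  let A := Z @^-1` [set Z w] in
  fine (\int[P]_(v in A) (f v)%:E) / fine (P A).

End probability.

(* Main.v *)
Require Import Defs.
From HB Require Import structures.
From mathcomp Require Import all_boot all_order all_algebra.
From mathcomp Require Import all_classical all_reals all_analysis.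
From mathcomp Require Import measurable_realfun.
From mathcomp Require Import zify ring lra.
Set Implicit Arguments.
Unset Strict Implicit.
Unset Printing Implicit Defensive.
Import Order.TTheory GRing.Theory Num.Theory.
Import numFieldNormedType.Exports.

(** The variance is bounded below by testing L(Z) against one explicit
    statistic of X. Write N1, N2, N3 for the numbers of blocks of X of lengths
    l-1, l, l+1, and let

      S = q1 q3 N2 (N2 - 1) - q2^2 N1 N3.

    Turning a short and a long block into two medium ones keeps the total length
    of X, hence the place where its last run is cut, and multiplies the
    probability of X by q2^2 / (q1 q3). Every ordered pair of distinct medium
    blocks arises in this way from exactly one short-long pair. So, for every
    function h of the string, with T_ij x the transformed string,

      E[q2^2 sum_(i short, j long) h(T_ij X)] = q1 q3 E[N2 (N2 - 1) h(X)]

    ([exchange_blocks]); equivalently ([stein_identity])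

      E[S h(X)] = E[q2^2 sum_(i short, j long) (h(T_ij X) - h(X))].

    This identity is used three times.
    - With h = 1 it gives E S = 0.
    - With h = S it gives E S^2 <= 8 n^3, since N1 N3 <= n^2 and one
      transformation increases S by at most 8 n ([stein_stat_square]).
    - With h = L(., Y) its right-hand side is
      q2^2 E[N1 N3 E[L(Zt) - L(Z) | Z]], where Zt is the transformed pair. By
      hypothesis the conditional mean is at least eps0 outside an event of
      probability at most exp(-n^alpha), on which it is still at least -n; and
      E[N1 N3] is at least of order n^2, because the first (n-1)/(l+1) runs, rounded
      down, are always blocks. Hence E[S L(Z)] >= c n^2 for n large.

    Finally Var L(Z) >= 2 t E[S L(Z)] - t^2 E[S^2] for every t, since
    Var(L(Z) - t S) >= 0; taking t of order 1/n gives a bound linear in n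
    ([weighted_variance_bound], [finite_variance_bound]).

    The computation takes place in a finite model: the first symbol, the lengths
    of the first n runs (they always fill n symbols) and the string Y. The
    integrals of the statement are turned into sums over this model by
    [law_X], [law_XY] and [mean_block_choice]. *)

(** * Runs and blocks of a truncated alternating concatenation *)

Definition alt_runs (b : bool) (w : nat -> nat) (m : nat) : seq (bool * nat) :=
  mkseq (fun k => (b (+) odd k, w k)) m.

Definition end_of (w : nat -> nat) (m : nat) : nat := \sum_(k < m) w k.

Lemma end_ofS w m : end_of w m.+1 = end_of w m + w m.
Proof. by rewrite /end_of big_ord_recr. Qed.

Lemma leq_end_of w m m' : m <= m' -> end_of w m <= end_of w m'.
Proof.
elim: m' => [|m' IH]; first by rewrite leqn0 => /eqP ->.
rewrite leq_eqVlt => /orP[/eqP -> //|]; rewrite ltnS => /IH h.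
by rewrite end_ofS; apply: leq_trans h (leq_addr _ _).
Qed.

Lemma unruns_cat r s : unruns (r ++ s) = unruns r ++ unruns s.
Proof. by rewrite /unruns map_cat flatten_cat. Qed.

Lemma size_unruns_alt b w m : size (unruns (alt_runs b w m)) = end_of w m.
Proof.
elim: m => [|m IH]; first by rewrite /end_of big_ord0.
by rewrite /alt_runs mkseqS -cats1 unruns_cat size_cat IH /unruns /= cats0 size_nseq
  end_ofS.
Qed.

Lemma alt_runs_cat b w m m' : m <= m' ->
  exists r, alt_runs b w m' = alt_runs b w m ++ r.
Proof.
elim: m' => [|m' IH]; first by rewrite leqn0 => /eqP ->; exists [::]; rewrite cats0.
rewrite leq_eqVlt => /orP[/eqP -> //|]; first by exists [::]; rewrite cats0.
rewrite ltnS => /IH[r E]; exists (rcons r (b (+) odd m', w m')).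
by rewrite /alt_runs mkseqS -rcons_cat -E.
Qed.

Lemma nth_unruns_alt b w m m' t : m <= m' -> t < end_of w m ->
  nth false (unruns (alt_runs b w m')) t = nth false (unruns (alt_runs b w m)) t.
Proof.
move=> /(alt_runs_cat b w)[r ->] h.
by rewrite unruns_cat nth_cat size_unruns_alt h.
Qed.

(** Positive run lengths: m runs fill at least m symbols, which is why n runs
    determine a string of length n. *)
Lemma end_of_ge w m : (forall k, k < m -> 0 < w k) -> m <= end_of w m.
Proof.
elim: m => [//|m IH] h; rewrite end_ofS.
have := IH (fun k hk => h k (ltnW hk)); have := h m (leqnn _); lia.
Qed.

(** Run K contains the n-th symbol, so that it is cut there and runs 0, ..., K-1 are
    exactly the blocks of the string of length n. *)
Definition last_run (w : nat -> nat) (n K : nat) : bool :=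
  end_of w K < n <= end_of w K.+1.

Lemma last_run_ex w n : (forall k, 0 < w k) -> 0 < n ->
  exists2 K, last_run w n K & K < n.
Proof.
move=> w0 n0.
have ex : exists m, n <= end_of w m by exists n; apply: end_of_ge.
case: (ex_minnP ex) => -[|K] hK hmin.
  by move: hK; rewrite /end_of big_ord0 leqNgt n0.
have hlt : end_of w K < n by rewrite ltnNge; apply/negP => /hmin; rewrite ltnn.
exists K; first by rewrite /last_run hlt.
by apply: leq_ltn_trans hlt; apply: end_of_ge.
Qed.

Lemma last_run_block w n K i : last_run w n K -> (end_of w i.+1 < n) = (i < K).
Proof.
case/andP=> h1 h2; case: (ltnP i K) => h.
  by apply: leq_ltn_trans h1; apply: leq_end_of.
by apply/negbTE; rewrite -leqNgt (leq_trans h2) // leq_end_of.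
Qed.

Definition cut_runs b w n K : seq (bool * nat) :=
  rcons (alt_runs b w K) (b (+) odd K, n - end_of w K).

Lemma take_unruns_last b w n K : last_run w n K ->
  take n (unruns (alt_runs b w K.+1)) = unruns (cut_runs b w n K).
Proof.
case/andP=> h1; rewrite end_ofS => h2.
rewrite /alt_runs mkseqS /cut_runs -!cats1 !unruns_cat take_cat.
rewrite size_unruns_alt ltnNge (ltnW h1) /= /unruns /= !cats0 take_nseq //; lia.
Qed.

Lemma run_stringE b w n K : (forall k, 0 < w k) -> last_run w n K ->
  run_string b w n = unruns (cut_runs b w n K) :> seq bool.
Proof.
move=> w0 hK; rewrite -take_unruns_last //.
have /andP[h1 h2] := hK.
have sz : size (take n (unruns (alt_runs b w K.+1))) = n.
  by rewrite size_takel // size_unruns_alt.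
apply: (@eq_from_nth _ false); first by rewrite sz size_tuple.
move=> t; rewrite size_tuple => tn.
rewrite -[t in LHS]/(nat_of_ord (Ordinal tn)) -tnth_nth tnth_mktuple /= nth_take //.
rewrite /run_symbol -/(alt_runs b w t.+1).
have tb : t < end_of w t.+1 by apply: end_of_ge.
have tK : t < end_of w K.+1 by apply: leq_trans h2.
case: (leqP K t) => h; last symmetry.
- exact: nth_unruns_alt.
- by apply: nth_unruns_alt => //; apply: ltnW.
Qed.

Lemma runs_nseq b k s : 0 < k -> (if runs s is (c, _) :: _ then c != b else true) ->
  runs (nseq k b ++ s) = (b, k) :: runs s.
Proof.
case: k => // k _ hs.
elim: k => [|k IH] /=.
  by case: (runs s) hs => [//|[c m] r] /negbTE /= ->.
by move: IH => /= ->; rewrite eqxx.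
Qed.

(** Run-length encoding is unique once adjacent symbols differ and no run is empty. *)
Lemma runs_unruns r : all (fun p => 0 < p.2) r ->
  sorted (fun p p' : bool * nat => p'.1 != p.1) r -> runs (unruns r) = r.
Proof.
elim: r => [//|[b k] r IH] /= /andP[k0 pos] srt.
rewrite /unruns /= -/(unruns r).
rewrite runs_nseq // IH ?(path_sorted srt) //.
by case: r srt {IH pos} => [//|[c m] r] /= /andP[].
Qed.

Lemma runs_cut b w n K : (forall k, 0 < w k) -> last_run w n K ->
  runs (unruns (cut_runs b w n K)) = cut_runs b w n K.
Proof.
move=> w0 /andP[h1 _]; apply: runs_unruns.
  rewrite /cut_runs all_rcons /= subn_gt0 h1 /=.
  by apply/allP => p /mapP[k _ ->] /=.
pose w' k := if k == K then n - end_of w K else w k.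
have -> : cut_runs b w n K = alt_runs b w' K.+1.
  rewrite /cut_runs /alt_runs mkseqS /w' eqxx; congr rcons.
  by apply/eq_in_map => k; rewrite mem_iota => /andP[_ kK]; rewrite ltn_eqF.
have srt m i : path (fun i j => j == i.+1) i (iota i.+1 m).
  by elim: m i => [//|m IH] i /=; rewrite eqxx IH.
apply: (@homo_sorted _ _ _ (fun i j => j == i.+1)); last exact: srt.
by move=> i j /eqP -> /=; case: b (odd i) => -[].
Qed.

Section String.
Variables (b : bool) (w : nat -> nat) (n K : nat).
Hypotheses (w0 : forall k, 0 < w k) (hK : last_run w n K).

Lemma runs_run_string : runs (run_string b w n) = cut_runs b w n K.
Proof. by rewrite (run_stringE b w0 hK) runs_cut. Qed.

Lemma run_length_cut i : i < K -> run_length (cut_runs b w n K) i = w i.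
Proof.
by move=> iK; rewrite /run_length /cut_runs nth_rcons size_mkseq iK nth_mkseq.
Qed.

Lemma blocks_run_string k :
  blocks k (run_string b w n) = [seq i <- iota 0 K | w i == k].
Proof.
rewrite /blocks runs_run_string {1}/cut_runs size_rcons size_mkseq /=.
by apply: eq_in_filter => i; rewrite mem_iota => /andP[_ iK]; rewrite run_length_cut.
Qed.

Lemma size_blocks_run_string k :
  size (blocks k (run_string b w n)) = \sum_(i < K) (w i == k).
Proof.
rewrite blocks_run_string size_filter -sum1_count big_mkcond.
rewrite (_ : iota 0 K = index_iota 0 K) ?big_mkord; last by rewrite /index_iota subn0.
by apply: eq_bigr => i _; case: eqP.
Qed.

Lemma mem_blocksP k i : i \in blocks k (run_string b w n) -> w i = k /\ i < K.
Proof. by rewrite blocks_run_string mem_filter mem_iota => /andP[/eqP]. Qed.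

End String.

(** The effect of the block transformation on the sequence of run lengths. *)
Definition equalize (l : nat) (w : nat -> nat) (i j : nat) : nat -> nat :=
  fun k => if (k == i) || (k == j) then l else w k.

Lemma equalize_gt0 l w i j : 1 < l -> (forall k, 0 < w k) ->
  forall k, 0 < equalize l w i j k.
Proof. by move=> /ltnW l0 w0 k; rewrite /equalize; case: ifP. Qed.

(** The two changes compensate, (l-1) + (l+1) = l + l, so everything that lies after
    both transformed runs stays at the same place. *)
Lemma end_of_equalize w l i j m : 1 < l -> w i = l.-1 -> w j = l.+1 ->
  i < m -> j < m ->
  end_of (equalize l w i j) m = end_of w m.
Proof.
move=> l2 wi wj im jm.
have ij : i != j by apply/eqP => E; move: wi; rewrite E wj; lia.
rewrite /end_of.
rewrite [LHS](bigD1 (Ordinal im)) // [RHS](bigD1 (Ordinal im)) //=.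
rewrite [X in _ + X](bigD1 (Ordinal jm)) /=; last by rewrite -val_eqE /= eq_sym.
rewrite [X in _ = _ + X](bigD1 (Ordinal jm)) /=; last by rewrite -val_eqE /= eq_sym.
rewrite /equalize !eqxx orbT /= wi wj !addnA; congr (_ + _); first lia.
apply: eq_bigr => k; rewrite -!val_eqE /= => /andP[/negbTE -> /negbTE ->] //.
Qed.

Section Transform.
Variables (b : bool) (w : nat -> nat) (n K l i j : nat).
Hypotheses (l2 : 1 < l) (w0 : forall k, 0 < w k) (hK : last_run w n K).
Hypotheses (iK : i < K) (jK : j < K) (wi : w i = l.-1) (wj : w j = l.+1).

Let ij : i != j.
Proof. by apply/eqP => E; move: wi; rewrite E wj; lia. Qed.

Lemma last_run_equalize : last_run (equalize l w i j) n K.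
Proof. by rewrite /last_run !(end_of_equalize l2 wi wj) // ltnW. Qed.

(** Since the last run is cut at the same place before and after, transforming the
    string amounts to transforming the run lengths and cutting again. *)
Lemma block_transform_run_string :
  block_transform l (run_string b w n) i j = run_string b (equalize l w i j) n.
Proof.
have ib : i \in blocks l.-1 (run_string b w n).
  by rewrite (blocks_run_string b w0 hK) mem_filter wi eqxx mem_iota.
have jb : j \in blocks l.+1 (run_string b w n).
  by rewrite (blocks_run_string b w0 hK) mem_filter wj eqxx mem_iota.
have hb : has_both_blocks l (run_string b w n).
  by apply/andP; split; [case: (blocks _ _) ib | case: (blocks _ _) jb].
rewrite /block_transform hb (runs_run_string b w0 hK).
rewrite (run_stringE b (equalize_gt0 i j l2 w0) last_run_equalize); congr unruns.
have szc w' : size (cut_runs b w' n K) = K.+1 by rewrite size_rcons size_mkseq.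
have szs : size (set_run_length (cut_runs b w n K) i l) = K.+1.
  by rewrite size_set_nth szc; apply/maxn_idPr; lia.
apply: (@eq_from_nth _ (false, 0)).
  by rewrite size_set_nth szs szc; apply/maxn_idPr; lia.
move=> k _; rewrite /set_run_length !nth_set_nth /= !nth_set_nth /=.
rewrite /cut_runs !nth_rcons !size_mkseq iK jK.
case: (ltnP k K) => kK.
  rewrite !nth_mkseq //.
  rewrite /equalize [j == i]eq_sym (negbTE ij) /=.
  by case: (k =P j) => [->|_]; rewrite ?orbT //; case: (k =P i) => [->|].
have -> : (k == j) = false by lia.
have -> : (k == i) = false by lia.
by rewrite (end_of_equalize l2 wi wj).
Qed.

End Transform.

Section Blocks.
Variables (b : bool) (w : nat -> nat) (n : nat).
Hypotheses (w0 : forall k, 0 < w k) (n0 : 0 < n).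

(** The index of the last run is eliminated here: being a block is expressed run by
    run, in a form over which sums can be exchanged. *)
Lemma blocks_ended k : blocks k (run_string b w n) =
  [seq i <- iota 0 n | (end_of w i.+1 < n) && (w i == k)].
Proof.
have [K hK Kn] := last_run_ex w0 n0.
have En : iota 0 n = iota 0 K ++ iota K (n - K).
  by rewrite -[K in X in _ ++ X]add0n -iotaD subnKC // ltnW.
rewrite (blocks_run_string b w0 hK) En filter_cat.
rewrite [X in _ ++ X](_ : _ = [::]) ?cats0.
  apply: eq_in_filter => i; rewrite mem_iota => /andP[_ iK].
  by rewrite (last_run_block i hK) iK.
apply/eqP; rewrite -size_eq0 size_filter -leqn0 leqNgt -has_count.
apply/hasPn => i; rewrite mem_iota => /andP[Ki _].
by rewrite (last_run_block i hK) ltnNge Ki.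
Qed.

Lemma size_blocks_le k : size (blocks k (run_string b w n)) <= n.
Proof.
by rewrite blocks_ended size_filter (leq_trans (count_size _ _)) ?size_iota.
Qed.

Section Equalize.
Variables (l i j : nat).
Hypotheses (l2 : 1 < l).
Hypotheses (ib : i \in blocks l.-1 (run_string b w n)).
Hypotheses (jb : j \in blocks l.+1 (run_string b w n)).

Lemma block_transformE :
  block_transform l (run_string b w n) i j = run_string b (equalize l w i j) n.
Proof.
have [K hK Kn] := last_run_ex w0 n0.
have [[wi iK] [wj jK]] := (mem_blocksP w0 hK ib, mem_blocksP w0 hK jb).
exact: (block_transform_run_string b l2 w0 hK).
Qed.

(** The counts of short, medium and long blocks change by -1, +2, -1; the identity is
    stated without subtraction and for all lengths at once. *)
Lemma size_blocks_transform k :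
  size (blocks k (block_transform l (run_string b w n) i j)) +
    ((l.-1 == k) + (l.+1 == k)) =
  size (blocks k (run_string b w n)) + ((l == k) + (l == k)).
Proof.
rewrite block_transformE.
have [K hK Kn] := last_run_ex w0 n0.
have [[wi iK] [wj jK]] := (mem_blocksP w0 hK ib, mem_blocksP w0 hK jb).
have hK' := last_run_equalize l2 hK iK jK wi wj.
rewrite (size_blocks_run_string b w0 hK).
rewrite (size_blocks_run_string b (equalize_gt0 i j l2 w0) hK').
have ij : i != j by apply/eqP => E; move: wi; rewrite E wj; lia.
rewrite (bigD1 (Ordinal iK)) // [X in _ = X + _](bigD1 (Ordinal iK)) //=.
rewrite (bigD1 (Ordinal jK)) /=; last by rewrite -val_eqE /= eq_sym.
rewrite [X in _ = _ + X + _](bigD1 (Ordinal jK)) /=; last by rewrite -val_eqE /= eq_sym.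
rewrite {1 2}/equalize !eqxx orbT /= wi wj.
set rest := (X in _ = _ + (_ + X) + _).
rewrite [X in _ + (_ + X) + _ = _](_ : _ = rest).
  by move: (nat_of_bool _) (nat_of_bool _) (nat_of_bool _) rest => *; lia.
rewrite /rest; apply: eq_bigr => m; rewrite -!val_eqE /equalize /=.
by move=> /andP[/negbTE -> /negbTE ->].
Qed.

End Equalize.
End Blocks.

Local Open Scope classical_set_scope.
Local Open Scope ring_scope.

(** * A finite model for the first runs, and the exchange identity *)

Local Notation short := (ord0 : 'I_3).
Local Notation medium := (Ordinal (isT : (1 < 3)%N) : 'I_3).
Local Notation long := (ord_max : 'I_3).

Section Model.
Variables (R : realFieldType) (l n : nat) (q : 'I_3 -> R).
Hypothesis l2 : (1 < l)%N.

Local Notation config := {ffun 'I_n -> 'I_3}.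

(** The default keeps all run lengths positive, so that every prefix of m runs fills at
    least m symbols. *)
Definition lengths (u : config) (k : nat) : nat :=
  if insub k is Some i then (l.-1 + u i)%N else l.

Definition weight (u : config) : R := \prod_k q (u k).

Definition str (b : bool) (u : config) : n.-tuple bool :=
  run_string b (lengths u) n.

Lemma lengths_ord u (i : 'I_n) : lengths u i = (l.-1 + u i)%N.
Proof. by rewrite /lengths valK. Qed.

Lemma lengths_gt0 u k : (0 < lengths u k)%N.
Proof. by rewrite /lengths; case: insub => [i|]; lia. Qed.

Lemma lengths_short u (i : 'I_n) : (lengths u i == l.-1) = (u i == short).
Proof. by rewrite lengths_ord -val_eqE /=; lia. Qed.

Lemma lengths_medium u (i : 'I_n) : (lengths u i == l) = (u i == medium).
Proof. by rewrite lengths_ord -val_eqE /=; lia. Qed.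

Lemma lengths_long u (i : 'I_n) : (lengths u i == l.+1) = (u i == long).
Proof. by rewrite lengths_ord -val_eqE /=; lia. Qed.

Definition ended (u : config) (i : 'I_n) : bool :=
  (end_of (lengths u) i.+1 < n)%N.

Definition pair_to_medium (i j : 'I_n) (u : config) :=
  [ffun k => if (k == i) || (k == j) then medium else u k].

Definition medium_to_pair (i j : 'I_n) (u : config) :=
  [ffun k => if k == i then short else if k == j then long else u k].

Lemma lengths_pair_to_medium i j u :
  lengths (pair_to_medium i j u) =1 equalize l (lengths u) i j.
Proof.
move=> k; rewrite /equalize /lengths.
case: insubP => [k' _ <-|/negbTE hk].
  by rewrite ffunE -!val_eqE; case: ifP => //= _; lia.
by case: ifP => // /orP[] /eqP E; move: hk; rewrite E ltn_ord.
Qed.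

(** Only the later of the two runs matters, and it ends at the same place before and
    after the transformation. *)
Lemma ended_pair_to_medium i j (u : config) : u i = short -> u j = long ->
  ended (pair_to_medium i j u) i && ended (pair_to_medium i j u) j =
  ended u i && ended u j.
Proof.
move=> ui uj.
have wi : lengths u i = l.-1 by apply/eqP; rewrite lengths_short ui.
have wj : lengths u j = l.+1 by apply/eqP; rewrite lengths_long uj.
have E m : (i < m)%N -> (j < m)%N ->
    end_of (lengths (pair_to_medium i j u)) m = end_of (lengths u) m.
  move=> im jm; rewrite -(end_of_equalize l2 wi wj im jm).
  by apply: eq_bigr => k _; apply: lengths_pair_to_medium.
have H w : (end_of w i.+1 < n)%N && (end_of w j.+1 < n)%N =
           (end_of w (maxn i j).+1 < n)%N.
  case: (leqP i j) => ij.
    by apply: andb_idl; apply: leq_ltn_trans; apply: leq_end_of.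
  by apply: andb_idr; apply: leq_ltn_trans; apply: leq_end_of; rewrite ltnW.
by rewrite /ended !H E // ltnS ?leq_maxl ?leq_maxr.
Qed.

(** The ratio of the two probabilities does not depend on the configuration: this is
    what makes the exchange identity exact. *)
Lemma weight_pair_to_medium i j (u : config) : u i = short -> u j = long ->
  q medium ^+ 2 * weight u = q short * q long * weight (pair_to_medium i j u).
Proof.
move=> ui uj.
have ij : i != j by apply/eqP => E; move: ui; rewrite E uj.
rewrite /weight (bigD1 i) //= (bigD1 j) 1?eq_sym //=.
rewrite [in RHS](bigD1 i) //= [in RHS](bigD1 j) 1?eq_sym //=.
rewrite !ffunE !eqxx orbT /= ui uj.
rewrite [in RHS](eq_bigr (fun k => q (u k))); first ring.
by move=> k /andP[/negbTE ki /negbTE kj]; rewrite ffunE ki kj.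
Qed.

Lemma pair_to_mediumK i j (u : config) : i != j ->
  (medium_to_pair i j (pair_to_medium i j u) == u) =
  (u i == short) && (u j == long).
Proof.
move=> ij; apply/eqP/andP => [<-|[/eqP ui /eqP uj]].
  by rewrite !ffunE !eqxx [j == i]eq_sym (negbTE ij).
by apply/ffunP => k; rewrite !ffunE; case: eqP => [->//|_]; case: eqP => [->|].
Qed.

Lemma medium_to_pairK i j (u : config) : u i = medium -> u j = medium ->
  pair_to_medium i j (medium_to_pair i j u) = u.
Proof.
move=> ui uj; apply/ffunP => k; rewrite !ffunE.
by case: (k =P i) => [->|_] //=; case: (k =P j) => [->|].
Qed.

Hypothesis n0 : (0 < n)%N.

Lemma sum_blocks b u k (F : nat -> R) :
  \sum_(i <- blocks k (str b u)) F i =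
  \sum_(i < n | ended u i && (lengths u i == k)) F i.
Proof.
rewrite (blocks_ended b (lengths_gt0 u) n0) big_filter.
by rewrite (_ : iota 0 n = index_iota 0 n) ?big_mkord // /index_iota subn0.
Qed.

Lemma size_blocks_sum b u k :
  (size (blocks k (str b u)))%:R = \sum_(i < n | ended u i && (lengths u i == k)) 1 :> R.
Proof. by rewrite -(sum_blocks b u k (fun=> 1)) big_const_seq count_predT iter_addr addr0. Qed.

Lemma transform_str b (u : config) (i j : 'I_n) :
  ended u i && (lengths u i == l.-1) -> ended u j && (lengths u j == l.+1) ->
  block_transform l (str b u) i j = str b (pair_to_medium i j u).
Proof.
move=> hi hj; rewrite /str (boolp.funext (lengths_pair_to_medium i j u)).
have ib : (i : nat) \in blocks l.-1 (run_string b (lengths u) n).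
  by rewrite (blocks_ended b (lengths_gt0 u) n0) mem_filter mem_iota leq0n ltn_ord !andbT.
have jb : (j : nat) \in blocks l.+1 (run_string b (lengths u) n).
  by rewrite (blocks_ended b (lengths_gt0 u) n0) mem_filter mem_iota leq0n ltn_ord !andbT.
by rewrite (block_transformE (lengths_gt0 u) n0 l2 ib jb).
Qed.

Lemma ordered_pairs_medium b (u : config) : let n2 := (size (blocks l (str b u)))%:R : R in
  n2 * (n2 - 1) = \sum_(i < n) \sum_(j < n | [&& i != j, ended u i && ended u j,
     u i == medium & u j == medium]) 1.
Proof.
rewrite /= size_blocks_sum mulrBr mulr1 mulr_suml.
rewrite -sumrB [RHS](bigID (fun i => ended u i && (u i == medium))) /=.
rewrite [X in _ = _ + X]big1 ?addr0; last first.
  move=> i h; apply: big_pred0 => j; apply/negbTE; apply: contra h.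
  by case/and4P => _ /andP[-> _] ->.
apply: eq_big => i; first by rewrite lengths_medium.
rewrite lengths_medium => /andP[ei ui].
rewrite mul1r (bigD1 i) /=; last by rewrite lengths_medium ei ui.
rewrite addrAC subrr add0r.
by apply: eq_bigl => j; rewrite lengths_medium ei ui [j == i]eq_sym andbC.
Qed.

(** For fixed distinct i and j, [pair_to_medium] is a bijection from the configurations
    in which block i is short and block j long onto those in which both are medium,
    and it multiplies the weight by a constant; summing over i and j gives the identity. *)
Lemma exchange_blocks b (h : seq bool -> R) :
  \sum_u weight u * (q medium ^+ 2 *
     \sum_(i <- blocks l.-1 (str b u)) \sum_(j <- blocks l.+1 (str b u))
        h (block_transform l (str b u) i j)) =
  \sum_u weight u * (q short * q long *
     ((size (blocks l (str b u)))%:R * ((size (blocks l (str b u)))%:R - 1) *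
       h (str b u))).
Proof.
(* Both sides become sums over i, j and u; the two inner sums over u are then
   matched by the bijection. *)
transitivity (\sum_(i < n) \sum_(j < n) \sum_(u | [&& ended u i && ended u j,
    u i == short & u j == long])
    weight u * (q medium ^+ 2 * h (str b (pair_to_medium i j u)))).
  under eq_bigr => u _.
    rewrite sum_blocks.
    under eq_bigr => i hi.
      rewrite sum_blocks; under eq_bigr => j hj do rewrite transform_str //.
      over.
    rewrite big_mkcond /=.
    under eq_bigr => i _.
      rewrite (_ : (if _ then _ else _) = \sum_(j < n | [&& ended u i && ended u j,
        u i == short & u j == long]) h (str b (pair_to_medium i j u))); last first.
        rewrite lengths_short; case: ifP => [/andP[-> ->]|/negbT hi].
          by apply: eq_bigl => j; rewrite lengths_long.
        rewrite big_pred0 // => j; apply: contraNF hi.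
        by case/and3P => /andP[-> _] ->.
      over.
    rewrite mulrA mulr_sumr.
    under eq_bigr => i _ do rewrite mulr_sumr.
    over.
  rewrite exchange_big; apply: eq_bigr => i _.
  rewrite (exchange_big_dep xpredT) //=; apply: eq_bigr => j _.
  by apply: eq_bigr => u _; rewrite mulrA.
transitivity (\sum_(i < n) \sum_(j < n) \sum_(u | [&& i != j, ended u i && ended u j,
    u i == medium & u j == medium])
    weight u * (q short * q long * h (str b u))); last first.
  apply/esym; under eq_bigr => u _.
    rewrite ordered_pairs_medium mulr_suml mulr_sumr mulr_sumr.
    under eq_bigr => i _.
      rewrite mulr_suml mulr_sumr mulr_sumr.
      under eq_bigr => j _ do rewrite mul1r.
      over.
    over.
  rewrite exchange_big; apply: eq_bigr => i _.
  by rewrite (exchange_big_dep xpredT).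
apply: eq_bigr => i _; apply: eq_bigr => j _.
have [->|ij] /= := eqVneq i j.
  by rewrite !big_pred0 // => u; case: eqP => [->|]; rewrite ?andbF.
rewrite [RHS](reindex_onto (pair_to_medium i j) (medium_to_pair i j)) /=; last first.
  by move=> u /and3P[_ /eqP ui /eqP uj]; rewrite medium_to_pairK.
apply: eq_big => u.
  rewrite pair_to_mediumK // !ffunE !eqxx orbT /= andbT.
  apply/idP/idP; case/and3P.
    by move=> e /eqP ui /eqP uj; rewrite ended_pair_to_medium // e ui uj !eqxx.
  by move=> e /eqP ui /eqP uj; rewrite -ended_pair_to_medium // e ui uj !eqxx.
by case/and3P => _ /eqP ui /eqP uj; rewrite mulrA [weight u * _]mulrC
   (weight_pair_to_medium ui uj) -!mulrA mulrCA; ring.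
Qed.
End Model.

(** * The variance bound in the finite model *)

(** Expand the nonnegative mean of (f - c - t S)^2, using that S has mean zero. The free
    parameter t replaces the Cauchy-Schwarz inequality. *)
Lemma weighted_variance_bound (R : realFieldType) (W : finType)
    (p f S D : W -> R) (c K t : R) :
  (forall w, 0 <= p w) -> \sum_w p w * S w = 0 ->
  \sum_w p w * (S w * f w) = \sum_w p w * D w ->
  \sum_w p w * S w ^+ 2 <= K ->
  2 * t * \sum_w p w * D w - t ^+ 2 * K <= \sum_w p w * (f w - c) ^+ 2.
Proof.
move=> p0 ES ESf ESS.
apply: (@le_trans _ _ (\sum_w p w * (2 * t * (S w * (f w - c)) - t ^+ 2 * S w ^+ 2))).
  have E w : p w * (2 * t * (S w * (f w - c)) - t ^+ 2 * S w ^+ 2) =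
      2 * t * (p w * (S w * f w)) -
      (2 * t * c * (p w * S w) + t ^+ 2 * (p w * S w ^+ 2)) by ring.
  rewrite (eq_bigr _ (fun w _ => E w)).
  rewrite sumrB big_split /= -!mulr_sumr ES ESf mulr0 add0r.
  by rewrite lerB // ler_wpM2l // sqr_ge0.
apply: ler_sum => w _; apply: ler_wpM2l => //.
rewrite -subr_ge0 (_ : _ - _ = (f w - c - t * S w) ^+ 2) ?sqr_ge0 //; ring.
Qed.

Section Moments.
Variables (R : realFieldType) (l n : nat) (q : 'I_3 -> R).
Hypotheses (l2 : (1 < l)%N) (n0 : (0 < n)%N).
Hypotheses (q0 : forall a, 0 <= q a) (q1 : \sum_a q a = 1).
Local Notation config := {ffun 'I_n -> 'I_3}.
Local Notation str := (str (n := n) l).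
Local Notation num k x := ((size (blocks k x))%:R : R).

Lemma weight_ge0 (u : config) : 0 <= weight q u.
Proof. exact: prodr_ge0. Qed.

Lemma sum_weight : \sum_(u : config) weight q u = 1.
Proof.
rewrite /weight -(bigA_distr_bigA (fun (k : 'I_n) a => q a)).
by rewrite big1 // => k _; rewrite q1.
Qed.

Lemma q_le1 a : q a <= 1.
Proof. by rewrite -q1 (bigD1 a) //= lerDl sumr_ge0. Qed.

Lemma prob_pair (i j : 'I_n) : i != j ->
  \sum_(u : config | (u i == short) && (u j == long)) weight q u = q short * q long.
Proof.
move=> ij; have ji : j != i by rewrite eq_sym.
pose G (k : 'I_n) (a : 'I_3) : R :=
  q a * ((k == i) ==> (a == short))%:R * ((k == j) ==> (a == long))%:R.
have -> : \sum_(u : config | (u i == short) && (u j == long)) weight q u =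
    \sum_(u : config) \prod_k G k (u k).
  rewrite big_mkcond /=; apply: eq_bigr => u _.
  rewrite (bigD1 i) // (bigD1 j) //= [in RHS]/G !eqxx.
  rewrite (negbTE ij) (negbTE ji) /= !mulr1.
  case: (u i == short) => /=; last by rewrite /= ?mulr0n ?(mulr0, mul0r).
  case: (u j == long) => /=; last by rewrite /= ?mulr0n !(mulr0, mul0r).
  rewrite /weight (bigD1 i) // (bigD1 j) //= !mulr1; congr (_ * (_ * _)).
  by apply: eq_bigr => k /andP[/negbTE -> /negbTE ->] /=; rewrite !mulr1.
rewrite -(bigA_distr_bigA G) (bigD1 i) // (bigD1 j) //=.
rewrite [X in _ * (_ * X)]big1 ?mulr1; last first.
  move=> k /andP[/negbTE ki /negbTE kj]; rewrite -[RHS]q1; apply: eq_bigr => a _.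
  by rewrite /G ki kj !mulr1.
congr (_ * _).
  rewrite (bigD1 short) //= big1 ?addr0 => [|a /negbTE h].
    by rewrite /G !eqxx (negbTE ij) !mulr1.
  by rewrite /G !eqxx h /= mulr0 mul0r.
rewrite (bigD1 long) //= big1 ?addr0 => [|a /negbTE h].
  by rewrite /G !eqxx (negbTE ji) !mulr1.
by rewrite /G !eqxx h /= mulr0.
Qed.

Lemma end_of_lengths_le (u : config) m : (end_of (lengths l u) m <= m * l.+1)%N.
Proof.
rewrite /end_of mulnC -[X in (_ <= _ * X)%N]card_ord -[X in (_ <= X)%N]mulnC -sum_nat_const.
apply: leq_sum => k _; rewrite /lengths; case: insub => [i|]; last lia.
by have := ltn_ord (u i); lia.
Qed.

(** The first m runs cover at most m (l+1) < n symbols, so they are always blocks;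
    among them each ordered pair of distinct runs is short-long with probability
    q short * q long. *)
Lemma mean_pairs_lower b m : (m * l.+1 < n)%N ->
  q short * q long * (m%:R * (m%:R - 1)) <= \sum_(u : config) weight q u *
    (num l.-1 (str b u) * num l.+1 (str b u)).
Proof.
move=> mn.
have mn' : (m <= n)%N by nia.
have Em : #|[pred j : 'I_n | (j < m)%N]| = m.
  rewrite -sum1_card -(big_ord_widen_cond n xpredT (fun=> 1%N) mn').
  by rewrite sum1_card card_ord.
have en (u : config) (i : 'I_n) : (i < m)%N -> ended l u i.
  move=> im; apply: leq_ltn_trans (end_of_lengths_le u i.+1) _; nia.
apply: (@le_trans _ _ (\sum_(u : config) \sum_(i < n | (i < m)%N)
    \sum_(j < n | (j < m)%N && (j != i)) weight q u * ((u i == short) && (u j == long))%:R)).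
  rewrite exchange_big /=.
  under eq_bigr => i im.
    rewrite exchange_big /=.
    under eq_bigr => j /andP[jm ji].
      rewrite (_ : \sum_u _ = q short * q long); last first.
        rewrite -(prob_pair (i := i) (j := j)) 1?eq_sym // [RHS]big_mkcond /=.
        by apply: eq_bigr => u _; case: (_ && _); rewrite ?mulr1 ?mulr0.
      over.
    over.
  rewrite (eq_bigr (fun=> q short * q long * (m%:R - 1))); last first.
    move=> i im; rewrite sumr_const -[LHS]mulr_natr; congr (_ * _).
    have := cardD1 i [pred j : 'I_n | (j < m)%N]; rewrite Em !inE im /= => E'.
    rewrite [X in X%:R - 1]E' add1n -natr1 addrK; congr _%:R; apply: eq_card => j.
    by rewrite !inE andbC.
  rewrite sumr_const -[leRHS]mulr_natr.
  by rewrite Em le_eqVlt; apply/orP; left; apply/eqP; ring.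
apply: ler_sum => u _; under eq_bigr => i _ do rewrite -mulr_sumr.
rewrite -mulr_sumr ler_wpM2l ?weight_ge0 //.
rewrite !size_blocks_sum // mulr_suml.
rewrite [X in X <= _]big_mkcond [X in _ <= X]big_mkcond /=; apply: ler_sum => i _.
rewrite lengths_short //.
case: ifP => im; last by case: ifP => // _; rewrite mul1r sumr_ge0.
rewrite en //=; case: eqP => _ /=; last by rewrite big1.
rewrite mul1r [X in X <= _]big_mkcond [X in _ <= X]big_mkcond /=; apply: ler_sum => j _.
rewrite lengths_long //; case: ifP => [/andP[jm _]|_].
  by rewrite en //=; case: eqP.
by case: ifP.
Qed.

(** Chosen so that E[S h(X)] is what E[q2^2 sum h(T_ij X)] gains over the same
    expression without T_ij. *)
Definition stein_stat (x : seq bool) : R :=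
  q short * q long * (num l x * (num l x - 1)) -
  q medium ^+ 2 * (num l.-1 x * num l.+1 x).

(** A quadratic polynomial of counts bounded by n, each of which changes by at most 2. *)
Lemma stein_stat_transform b (u : config) i j :
  i \in blocks l.-1 (str b u) -> j \in blocks l.+1 (str b u) ->
  stein_stat (block_transform l (str b u) i j) - stein_stat (str b u) <= 8 * n%:R.
Proof.
move=> ib jb.
have H := size_blocks_transform (lengths_gt0 l2 u) n0 l2 ib jb.
have le := size_blocks_le b (lengths_gt0 l2 u) n0.
have := H l; have := H l.-1; have := H l.+1.
have := le l; have := le l.-1; have := le l.+1.
rewrite /stein_stat -![run_string _ _ _]/(str b u) !eqxx.
have -> : (l.-1 == l) = false by lia.
have -> : (l.-1 == l.+1) = false by lia.
have -> : (l.+1 == l.-1) = false by lia.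
have -> : (l.+1 == l) = false by lia.
have -> : (l == l.+1) = false by lia.
have -> : (l == l.-1) = false by lia.
set x := str b u; set x' := block_transform _ _ _ _.
move: (size (blocks l.-1 x)) (size (blocks l x)) (size (blocks l.+1 x))
  (size (blocks l.-1 x')) (size (blocks l x')) (size (blocks l.+1 x')).
move=> a c e a' c' e' he ha hc E1 E2 E3.
have -> : a = a'.+1 by lia.
have -> : e = e'.+1 by lia.
have -> : c' = c.+2 by lia.
have c_n : c%:R <= n%:R :> R by rewrite ler_nat.
have a_n : a'%:R + 1 <= n%:R :> R by rewrite natr1 ler_nat; lia.
have e_n : e'%:R + 1 <= n%:R :> R by rewrite natr1 ler_nat; lia.
have n1 : 1 <= n%:R :> R by rewrite ler1n.
rewrite -!natr1.
have c0 := ler0n R c; have a0 := ler0n R a'; have e0 := ler0n R e'.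
have qq : q short * q long <= 1 by rewrite mulr_ile1 ?q_le1.
have qm : q medium ^+ 2 <= 1 by rewrite exprn_ile1 ?q_le1.
rewrite (_ : _ - _ = (q short * q long) * (4 * c%:R + 2) +
   q medium ^+ 2 * (a'%:R + e'%:R + 1)); last by ring.
have h1 : (q short * q long) * (4 * c%:R + 2) <= 4 * c%:R + 2.
  by rewrite ler_piMl //; lra.
have h2 : q medium ^+ 2 * (a'%:R + e'%:R + 1) <= a'%:R + e'%:R + 1.
  by rewrite ler_piMl //; lra.
lra.
Qed.

Local Notation outcome := ((bool * config) * n.-tuple bool)%type.
Local Notation xstr w := (str w.1.1 w.1.2).

Section Pair.
Variable (r : n.-tuple bool -> R).
Hypotheses (r0 : forall y, 0 <= r y) (r1 : \sum_y r y = 1).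

Definition mass (w : outcome) : R := 2^-1 * weight q w.1.2 * r w.2.

Lemma mass_ge0 w : 0 <= mass w.
Proof. by rewrite /mass !mulr_ge0 ?weight_ge0 ?invr_ge0. Qed.

Lemma sum_massE (F : outcome -> R) : \sum_w mass w * F w =
  \sum_b \sum_y (2^-1 * r y) * \sum_(u : config) weight q u * F ((b, u), y).
Proof.
transitivity (\sum_v \sum_y mass (v, y) * F (v, y)).
  by rewrite pair_bigA; apply: eq_bigr => -[].
transitivity (\sum_b \sum_u \sum_y mass ((b, u), y) * F ((b, u), y)).
  by rewrite [RHS]pair_bigA; apply: eq_bigr => -[].
apply: eq_bigr => b _; rewrite exchange_big; apply: eq_bigr => y _ /=.
by rewrite mulr_sumr; apply: eq_bigr => u _; rewrite /mass /=; ring.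
Qed.

Lemma sum_mass_cst c : \sum_w mass w * c = c.
Proof.
rewrite sum_massE.
under eq_bigr => b _.
  under eq_bigr => y _ do rewrite -mulr_suml sum_weight mul1r -mulrA.
  rewrite -mulr_sumr -mulr_suml r1 mul1r.
  over.
by rewrite sumr_const card_bool -[LHS]mulr_natr; lra.
Qed.

Lemma exchange_mass (h : seq bool -> n.-tuple bool -> R) :
  \sum_w mass w * (q medium ^+ 2 *
     \sum_(i <- blocks l.-1 (xstr w)) \sum_(j <- blocks l.+1 (xstr w))
        h (block_transform l (xstr w) i j) w.2) =
  \sum_w mass w * (q short * q long *
     (num l (xstr w) *
       (num l (xstr w) - 1) * h (xstr w) w.2)).
Proof.
rewrite !sum_massE; apply: eq_bigr => b _; apply: eq_bigr => y _; congr (_ * _).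
exact: (exchange_blocks q l2 n0 b (h ^~ y)).
Qed.

(** When x has blocks of both lengths, this is the number of short-long pairs times the
    mean change of f under the block transformation. *)
Definition drift (f : seq bool -> n.-tuple bool -> R) (x : seq bool) y : R :=
  \sum_(i <- blocks l.-1 x) \sum_(j <- blocks l.+1 x)
    (f (block_transform l x i j) y - f x y).

Lemma driftE f x y : drift f x y =
  \sum_(i <- blocks l.-1 x) \sum_(j <- blocks l.+1 x) f (block_transform l x i j) y -
  num l.-1 x * num l.+1 x * f x y.
Proof.
rewrite /drift; under eq_bigr => i _ do rewrite sumrB big_const_seq count_predT iter_addr_0.
rewrite sumrB; congr (_ - _).
rewrite big_const_seq count_predT iter_addr_0 -mulrnA -[LHS]mulr_natl mulnC.
by rewrite natrM.
Qed.

(** The exchange identity, with the terms containing the untransformed string moved to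
    the side of the statistic. *)
Lemma stein_identity (f : seq bool -> n.-tuple bool -> R) :
  \sum_w mass w * (stein_stat (xstr w) * f (xstr w) w.2) =
  \sum_w mass w * (q medium ^+ 2 * drift f (xstr w) w.2).
Proof.
under [RHS]eq_bigr => w _ do rewrite driftE mulrBr mulrBr.
rewrite sumrB exchange_mass -sumrB; apply: eq_bigr => w _.
rewrite /stein_stat; ring.
Qed.

Lemma stein_stat_mean : \sum_w mass w * stein_stat (xstr w) = 0.
Proof.
have := stein_identity (fun _ _ => 1).
under eq_bigr => w _ do rewrite mulr1.
move=> ->; rewrite big1 // => w _; rewrite /drift big1 ?mulr0 // => i _.
by rewrite big1 // => j _; rewrite subrr.
Qed.

Lemma pairs_le (w : outcome) : num l.-1 (xstr w) *
   num l.+1 (xstr w) <= n%:R ^+ 2 :> R.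
Proof.
by rewrite expr2 ler_pM ?ler0n // ler_nat (size_blocks_le _ (lengths_gt0 l2 _)).
Qed.

Lemma drift_le (f : seq bool -> n.-tuple bool -> R) (w : outcome) (c : R) :
  (forall i j, i \in blocks l.-1 (xstr w) ->
    j \in blocks l.+1 (xstr w) ->
    f (block_transform l (xstr w) i j) w.2 - f (xstr w) w.2 <= c) ->
  drift f (xstr w) w.2 <= 
   num l.-1 (xstr w) * num l.+1 (xstr w) * c.
Proof.
move=> h; rewrite /drift.
apply: (@le_trans _ _ (\sum_(i <- blocks l.-1 (xstr w))
    \sum_(j <- blocks l.+1 (xstr w)) c)).
  by rewrite big_seq [leRHS]big_seq; apply: ler_sum => i hi;
     rewrite big_seq [leRHS]big_seq; apply: ler_sum => j hj; apply: h.
rewrite !big_const_seq !count_predT !iter_addr_0 -mulrnA -[leLHS]mulr_natl mulnC.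
by rewrite natrM.
Qed.

(** The identity applied to the statistic itself turns a second moment, which would
    otherwise need concentration of the block counts, into a first-order change. *)
Lemma stein_stat_square : \sum_w mass w * stein_stat (xstr w) ^+ 2 <= 8 * n%:R ^+ 3.
Proof.
have := stein_identity (fun x _ => stein_stat x).
under eq_bigr => w _ do rewrite -expr2.
move=> ->; rewrite -[leRHS]sum_mass_cst; apply: ler_sum => w _.
apply: ler_wpM2l; first exact: mass_ge0.
have h := @drift_le (fun x _ => stein_stat x) w (8 * n%:R)
   (fun i j => @stein_stat_transform w.1.1 w.1.2 i j).
have qm : q medium ^+ 2 <= 1 by rewrite exprn_ile1 ?q_le1.
apply: (@le_trans _ _ (q medium ^+ 2 * (8 * n%:R ^+ 3))); last first.
  by rewrite ler_piMl // mulr_ge0 // exprn_ge0.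
apply: ler_wpM2l; first exact: sqr_ge0.
apply: le_trans h _; have := pairs_le w; move: (_ * _) => a an.
rewrite (_ : 8 * n%:R ^+ 3 = n%:R ^+ 2 * (8 * n%:R)); last by ring.
by rewrite ler_wpM2r // mulr_ge0.
Qed.

(** Here [bad] marks the outcomes where the drift may be small; there it is bounded
    below by -n for each of the at most n^2 pairs. *)
Lemma finite_variance_bound (f : seq bool -> n.-tuple bool -> R)
    (bad : pred outcome) (eps delta c t : R) (m : nat) :
  0 <= eps -> 0 <= t -> (m * l.+1 < n)%N ->
  (forall x y, 0 <= f x y) -> (forall x : n.-tuple bool, forall y, f x y <= n%:R) ->
  (forall w, ~~ bad w -> eps * (num l.-1 (xstr w) *
     num l.+1 (xstr w)) <= drift f (xstr w) w.2) ->
  \sum_w mass w * (bad w)%:R <= delta ->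
  2 * t * (q medium ^+ 2 * (eps * (q short * q long * (m%:R * (m%:R - 1))) -
     (eps + n%:R) * n%:R ^+ 2 * delta)) - t ^+ 2 * (8 * n%:R ^+ 3) <=
  \sum_w mass w * (f (xstr w) w.2 - c) ^+ 2.
Proof.
move=> eps0 t0 mn f0 fn hgood hdelta.
have H := weighted_variance_bound c t mass_ge0 stein_stat_mean (stein_identity f) stein_stat_square.
apply: le_trans H; rewrite lerB //; apply: ler_wpM2l; first by rewrite mulr_ge0.
under [leRHS]eq_bigr => w _ do rewrite mulrCA.
rewrite -mulr_sumr; apply: ler_wpM2l; first exact: sqr_ge0.
pose n13 (w : outcome) : R := num l.-1 (xstr w) *
     num l.+1 (xstr w).
apply: (@le_trans _ _ (\sum_w mass w * (eps * n13 w - (eps + n%:R) * n%:R ^+ 2 * (bad w)%:R))).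
  under [leRHS]eq_bigr => w _ do rewrite mulrBr mulrCA [X in _ - X]mulrCA.
  rewrite sumrB -!mulr_sumr lerB //; last first.
    by apply: ler_wpM2l => //; rewrite mulr_ge0 ?addr_ge0 ?exprn_ge0.
  apply: ler_wpM2l => //.
  rewrite -[leLHS]sum_mass_cst !sum_massE; apply: ler_sum => b _; apply: ler_sum => y _.
  apply: ler_wpM2l; first by rewrite mulr_ge0 ?invr_ge0.
  by rewrite -mulr_suml sum_weight mul1r; apply: mean_pairs_lower.
apply: ler_sum => w _; apply: ler_wpM2l; first exact: mass_ge0.
have n13_0 : 0 <= n13 w by rewrite mulr_ge0.
have n13_n := pairs_le w; rewrite -/(n13 w) in n13_n.
case: (boolP (bad w)) => [_|/hgood h0]; last by rewrite mulr0 subr0.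
have h := @drift_le (fun x y => - f x y) w n%:R _.
rewrite mulr1 -lerN2.
apply: (@le_trans _ _ (n13 w * n%:R)).
  rewrite [leLHS](_ : _ = drift (fun x y => - f x y) (xstr w) w.2); last first.
    rewrite /drift -sumrN; apply: eq_bigr => i _; rewrite -sumrN.
    by apply: eq_bigr => j _; rewrite opprB opprK addrC.
  apply: h => i j _ _; rewrite opprK addrC; have := f0 (block_transform l (xstr w) i j) w.2.
  have := fn (xstr w) w.2; lra.
have : (eps + n%:R) * n13 w <= (eps + n%:R) * n%:R ^+ 2.
  by apply: ler_wpM2l => //; rewrite addr_ge0.
rewrite opprB; lra.
Qed.

End Pair.
End Moments.

(** * Random variables with countably many values *)

(** A notion of discrete random variable without a sigma-algebra on the codomain. *)
Definition measurable_fibers d (T : measurableType d) (S : Type) (Q : T -> S) :=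
  forall s, measurable (Q @^-1` [set s]).

Lemma measurable_preimage_count d (T : measurableType d) (S : countType) (Q : T -> S)
  (B : set S) : measurable_fibers Q -> measurable (Q @^-1` B).
Proof.
move=> mQ.
have -> : Q @^-1` B = \bigcup_(s : S) [set w | B s /\ Q w = s].
  apply/seteqP; split => [w Bw|w [s _ /= [Bs E]]]; last by rewrite E.
  by exists (Q w) => //; split.
apply: countable_bigcupT_measurable => [|s]; first exact: countableP.
have [Bs|nBs] := pselect (B s).
  rewrite (_ : [set _ | _] = Q @^-1` [set s]); first exact: mQ.
  by apply/seteqP; split => w //= [].
by rewrite (_ : [set _ | _] = set0) //; apply/seteqP; split => w //= [].
Qed.

Lemma measurable_fibers_comp d (T : measurableType d) (S : countType) (S' : Type)
  (Q : T -> S) (g : S -> S') : measurable_fibers Q -> measurable_fibers (g \o Q).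
Proof.
by move=> mQ s; rewrite comp_preimage; apply: measurable_preimage_count.
Qed.

Lemma measurable_fibers_pair d (T : measurableType d) (S S' : Type)
  (Q : T -> S) (Q' : T -> S') : measurable_fibers Q -> measurable_fibers Q' ->
  measurable_fibers (fun w => (Q w, Q' w)).
Proof.
move=> mQ mQ' [s s'].
rewrite (_ : _ @^-1` _ = Q @^-1` [set s] `&` Q' @^-1` [set s']).
  exact: measurableI.
by apply/seteqP; split => w /= => [[-> ->]|[-> ->]].
Qed.

Lemma measurable_fibers_tuple d (T : measurableType d) (S : Type) n
  (Q : 'I_n -> T -> S) : (forall i, measurable_fibers (Q i)) ->
  measurable_fibers (fun w => [tuple Q i w | i < n]).
Proof.
move=> mQ t.
rewrite (_ : _ @^-1` _ = \bigcap_(i in [set: 'I_n]) (Q i @^-1` [set tnth t i])).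
  by apply: fin_bigcap_measurable => [|i _]; [exact: finite_finset | exact: mQ].
apply/seteqP; split => w /= => [<- i _|h]; first by rewrite /= tnth_mktuple.
by apply: eq_from_tnth => i; rewrite tnth_mktuple; apply: h.
Qed.

Lemma measurable_tuple_set1 n (t : n.-tuple bool) : measurable [set t].
Proof.
have := @measurable_fibers_tuple _ (n.-tuple bool) bool n (fun i s => tnth s i).
move=> h; have {h} := h (fun i => _) t.
rewrite (_ : _ @^-1` _ = [set t]).
  by apply=> i b; rewrite -[X in measurable X]setTI; apply: measurable_tnth.
apply/seteqP; split => s /=.
  by move=> <-; apply: eq_from_tnth => i; rewrite tnth_mktuple.
by move=> ->; apply: eq_from_tnth => i; rewrite tnth_mktuple.
Qed.

Section FiniteRange.
Context d (T : measurableType d) (R : realType) (P : probability T R).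

Definition pr (A : set T) : R := fine (P A).

Lemma prE A : measurable A -> P A = (pr A)%:E.
Proof. by move=> mA; rewrite /pr fineK // fin_num_measure. Qed.

Lemma pr_ge0 A : 0 <= pr A.
Proof. by rewrite fine_ge0. Qed.

Lemma prT : pr setT = 1.
Proof. by rewrite /pr probability_setT. Qed.

Lemma le_pr A B : measurable A -> measurable B -> A `<=` B -> pr A <= pr B.
Proof. by move=> mA mB AB; rewrite -lee_fin -!prE // le_measure ?inE. Qed.

Lemma prU A B : measurable A -> measurable B -> A `&` B = set0 ->
  pr (A `|` B) = pr A + pr B.
Proof.
move=> mA mB AB; apply: EFin_inj; rewrite EFinD -!prE //; first exact: measureU.
exact: measurableU.
Qed.

Section Range.
Context (S : countType) (Q : T -> S).
Hypothesis mQ : measurable_fibers Q.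

Lemma pr_mem D (s : seq S) : measurable D -> uniq s ->
  pr (D `&` [set w | Q w \in s]) = \sum_(k <- s) pr (D `&` Q @^-1` [set k]).
Proof.
move=> mD; elim: s => [_|k s IH /= /andP[ks us]].
  rewrite big_nil (_ : _ `&` _ = set0) ?/pr ?measure0 //.
  by apply/seteqP; split => w //= [].
rewrite big_cons -IH // -prU.
- congr pr; apply/seteqP; split => w /=.
    by case=> Dw; rewrite inE => /orP[/eqP|]; [left | right].
  by case=> -[Dw]; rewrite inE => ->; split; rewrite ?eqxx ?orbT.
- exact: measurableI.
- apply: measurableI => //; exact: (measurable_preimage_count [set x | x \in s]).
- by apply/seteqP; split => w //= [[_ ->] [_ h]]; rewrite h in ks.
Qed.

Lemma pr_split D (p : pred S) : measurable D ->
  pr D = pr (D `&` [set w | p (Q w)]) + pr (D `&` [set w | ~~ p (Q w)]).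
Proof.
move=> mD.
have mp (p' : pred S) : measurable (D `&` [set w | p' (Q w)]).
  by apply: measurableI => //; exact: (measurable_preimage_count [set x | p' x]).
have m1 := mp p; have m2 : measurable (D `&` [set w | ~~ p (Q w)]) := mp (predC p).
rewrite -prU //.
  congr pr; apply/seteqP; split => w /=; last by case=> -[].
  by move=> Dw; case: (boolP (p (Q w))) => ?; [left | right].
by apply/seteqP; split => w //= [[_ h1] [_ /negP]].
Qed.

Lemma pr_sum D (s : seq S) : measurable D -> uniq s ->
  pr (D `&` [set w | Q w \notin s]) = 0 ->
  pr D = \sum_(k <- s) pr (D `&` Q @^-1` [set k]).
Proof.
by move=> mD us h; rewrite -pr_mem // (pr_split (mem s) mD) h addr0.
Qed.

Lemma measurable_fun_count D (f : S -> R) : measurable D ->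
  measurable_fun D (EFin \o (f \o Q)).
Proof.
move=> mD; apply/measurable_EFinP => _ B mB; apply: measurableI => //.
exact: (measurable_preimage_count (f @^-1` B)).
Qed.

(** Only the values in [s] carry mass in [D], although [Q] may take infinitely many:
    this is the form needed for the two random indices of the block transformation. *)
Lemma integral_comp_count D (s : seq S) (f : S -> R) : measurable D -> uniq s ->
  pr (D `&` [set w | Q w \notin s]) = 0 ->
  (\int[P]_(w in D) (f (Q w))%:E =
   (\sum_(k <- s) f k * pr (D `&` Q @^-1` [set k]))%:E)%E.
Proof.
move=> mD us h.
have mF k : measurable (Q @^-1` [set k]) by [].
have int k : P.-integrable D (fun w => (\1_(Q @^-1` [set k]) w)%:E).
  by apply: integrableS (integrable_indic _ (mF k)).
rewrite (@ae_eq_integral _ _ _ _ _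
    (fun w => \sum_(k <- s) ((f k)%:E * (\1_(Q @^-1` [set k]) w)%:E)%E)) //.
- rewrite integral_sum //; last by move=> k; apply: integrableZl.
  rewrite -sumEFin; apply: eq_bigr => k _.
  rewrite integralZl // integral_indic // EFinM -prE 1?setIC //; exact: measurableI.
- exact: (measurable_fun_count f).
- apply: emeasurable_sum => k; apply: measurable_int; exact: integrableZl.
- exists (D `&` [set w | Q w \notin s]).
  have m2 : measurable (D `&` [set w | Q w \notin s]).
    by apply: measurableI => //; exact: (measurable_preimage_count [set x | x \notin s]).
  split => //; first by have := prE m2; rewrite h.
  move=> w /= /not_implyP[Dw neq]; split => //; apply/negP => Qs; apply: neq.
  rewrite (bigD1_seq (Q w)) //= indicE mem_set // mule1 big1 ?adde0 // => k kQ.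
  rewrite indicE memNset ?mule0 //= => E; by rewrite E eqxx in kQ.
Qed.

End Range.

Lemma pr_sum_fin (S : finType) (Q : T -> S) D : measurable_fibers Q -> measurable D ->
  pr D = \sum_k pr (D `&` Q @^-1` [set k]).
Proof.
move=> mQ mD; apply: pr_sum => //; first exact: index_enum_uniq.
rewrite (_ : _ `&` _ = set0) ?/pr ?measure0 //.
by apply/seteqP; split => w //= [_]; rewrite mem_index_enum.
Qed.

Lemma integral_fin (S : finType) (Q : T -> S) (f : S -> R) : measurable_fibers Q ->
  (\int[P]_w (f (Q w))%:E = (\sum_k f k * pr (Q @^-1` [set k]))%:E)%E.
Proof.
move=> mQ; rewrite (integral_comp_count (s := index_enum S) mQ) //.
- by congr EFin; apply: eq_bigr => k _; rewrite setTI.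
- exact: index_enum_uniq.
rewrite (_ : _ `&` _ = set0) ?/pr ?measure0 //.
by apply/seteqP; split => w //= [_]; rewrite mem_index_enum.
Qed.

Lemma variance_fin (S : finType) (Q : T -> S) (f : S -> R) : measurable_fibers Q ->
  exists c, ('V_P[fun w => f (Q w)] =
    (\sum_k (f k - c) ^+ 2 * pr (Q @^-1` [set k]))%:E)%E.
Proof.
move=> mQ; exists (fine 'E_P[fun w => f (Q w)])%E.
set c := fine _.
rewrite -(integral_fin (fun k => (f k - c) ^+ 2) mQ) /variance covariance.unlock -/c.
rewrite expectation.unlock; apply: eq_integral => w _ /=.
by rewrite expr2.
Qed.

End FiniteRange.

(** * The law of the strings and of the random choice of blocks *)

Lemma eq_run_string b (w w' : nat -> nat) n :
  (forall k, (k < n)%N -> w k = w' k) -> run_string b w n = run_string b w' n.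
Proof.
move=> h; apply: eq_from_tnth => i; rewrite !tnth_mktuple /run_symbol.
congr (nth _ (unruns _) _); apply/eq_in_map => k; rewrite mem_iota => /andP[_ ki].
by rewrite h //; apply: leq_trans ki _; rewrite add0n.
Qed.

Section Law.
Context d (T : measurableType d) (R : realType) (P : probability T R).
Variables (l : nat) (q1 q2 q3 : R) (th : {RV P >-> bool}) (W : nat -> {RV P >-> nat}).
Hypotheses (l2 : (1 < l)%N) (model : multinomial_blocks l q1 q2 q3 th W).

Definition length_law (a : 'I_3) : R := [:: q1; q2; q3]`_a.

Variable n : nat.
Local Notation config := {ffun 'I_n -> 'I_3}.

Definition first_runs (v : bool * config) : set T :=
  [set w | th w = v.1 /\ forall k, (k < n)%N -> W k w = lengths l v.2 k].

Lemma first_runsE v : first_runs v = \bigcap_(i in [set` None :: map Some (iota 0 n)])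
  (if i is Some k then W k @^-1` [set lengths l v.2 k] else th @^-1` [set v.1]).
Proof.
apply/seteqP; split => w /=.
  case=> hth hW [k|] //=; rewrite inE /= mem_map ?mem_iota; last by move=> ? ? [].
  by rewrite add0n => /andP[_]; apply: hW.
move=> h; split; first exact: (h None).
move=> k kn; apply: (h (Some k)); rewrite /= inE /= mem_map ?mem_iota //.
Qed.

Lemma measurable_first_runs v : measurable (first_runs v).
Proof.
rewrite first_runsE; apply: fin_bigcap_measurable; first exact: finite_seq.
by move=> [k|] _; apply: measurable_funPTI.
Qed.

Lemma pr_run_length k a : P (W k @^-1` [set (l.-1 + nat_of_ord a)%N]) = (length_law a)%:E.
Proof.
rewrite /length_law; case: a => -[|[|[|//]]] i /=.
- by rewrite addn0 (block_law1 model).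
- by rewrite addn1 prednK ?(block_law2 model) // ltnW.
- by rewrite addn2 prednK ?(block_law3 model) // ltnW.
Qed.

Lemma pr_first_runs v : pr P (first_runs v) = 2^-1 * weight length_law v.2.
Proof.
rewrite /pr first_runsE (blocks_indep model); last first.
- move=> [k|] _; rewrite /events_of /preimage_set_system /=.
    by exists [set lengths l v.2 k] => //; rewrite setTI.
  by exists [set v.1] => //; rewrite setTI.
- rewrite /= map_inj_uniq ?iota_uniq ?andbT; last by move=> ? ? [].
  by apply/mapP => -[].
rewrite big_cons big_map (first_symbol_unif model).
rewrite (_ : iota 0 n = index_iota 0 n) ?big_mkord; last by rewrite /index_iota subn0.
rewrite (eq_bigr (fun k : 'I_n => (length_law (v.2 k))%:E)); last first.
  by move=> k _; rewrite lengths_ord pr_run_length.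
by rewrite prodEFin -EFinM.
Qed.

(** The events are disjoint since l - 1 + a determines a. *)
Lemma first_runs_inj v v' w : first_runs v w -> first_runs v' w -> v = v'.
Proof.
case: v v' => [b u] [b' u'] /= [/= hb hu] [/= hb' hu'].
congr (_, _); first by rewrite -hb -hb'.
apply/ffunP => k; apply/val_inj/(@addnI l.-1).
by rewrite -!lengths_ord -hu // -hu'.
Qed.

Hypothesis (qsum : \sum_a length_law a = 1).

Variable X : T -> n.-tuple bool.
Hypothesis X_def : forall w, X w = run_string (th w) (fun k => W k w) n.

Lemma measurable_fibers_X : measurable_fibers X.
Proof.
pose Q w := (th w, [tuple W k w | k < n]).
have -> : X = (fun bt : bool * n.-tuple nat => run_string bt.1 (nth 0%N bt.2) n) \o Q.
  apply/funext => w; rewrite X_def /=; apply: eq_run_string => k kn.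
  have := tnth_mktuple (fun i : 'I_n => W i w) (Ordinal kn).
  by rewrite (tnth_nth 0%N) => ->.
apply: measurable_fibers_comp; apply: measurable_fibers_pair.
  by move=> b; apply: measurable_funPTI.
by apply: measurable_fibers_tuple => i k; apply: measurable_funPTI.
Qed.

Lemma X_first_runs v w : first_runs v w -> X w = str l v.1 v.2.
Proof. by case=> hb hu; rewrite X_def hb; apply: eq_run_string. Qed.

(** The events [first_runs v] are disjoint with total mass one, so almost surely one of
    them occurs, and it determines X. *)
Lemma law_X x :
  pr P (X @^-1` [set x]) = \sum_v 2^-1 * weight length_law v.2 * (str l v.1 v.2 == x)%:R.
Proof.
(* V is None on the null event where some run length is not l-1, l or l+1. *)
pose V w := [pick v | `[< first_runs v w >] ].
have VE v : V @^-1` [set Some v] = first_runs v.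
  apply/seteqP; split => w /=; rewrite /V; case: pickP.
  - by move=> v' /asboolP h [<-].
  - by [].
  - by move=> v' /asboolP h h'; rewrite (first_runs_inj h h').
  - by move=> h /asboolP; rewrite h.
have VN : V @^-1` [set None] = ~` \bigcup_(v in [set: bool * config]) first_runs v.
  apply/seteqP; split => w /=; rewrite /V; case: pickP.
  - by [].
  - by move=> h _ [v _ /asboolP]; rewrite h.
  - by move=> v /asboolP h; case; exists v.
  - by [].
have mV : measurable_fibers V.
  case=> [v|]; first by rewrite VE; apply: measurable_first_runs.
  rewrite VN; apply: measurableC; apply: fin_bigcup_measurable => [|v _].
    exact: finite_finset.
  exact: measurable_first_runs.
have mX := measurable_fibers_X x.
have split_option (F : option (bool * config) -> R) : \sum_k F k = F None + \sum_v F (Some v).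
  rewrite (bigD1 None) //=; congr (_ + _).
  rewrite (reindex_omap Some id) /=; last by case.
  by apply: eq_bigl => v; rewrite eqxx.
have tot := @pr_sum_fin _ _ _ P _ V setT mV measurableT.
have sumV : \sum_v pr P (setT `&` V @^-1` [set Some v]) = 1.
  rewrite (eq_bigr (fun v : bool * config => 2^-1 * weight length_law v.2)); last first.
    by move=> v _; rewrite setTI VE pr_first_runs.
  rewrite -(pair_bigA _ (fun (b : bool) (u : config) => 2^-1 * weight length_law u)) /=.
  under eq_bigr => b _ do rewrite -mulr_sumr sum_weight // mulr1.
  by rewrite sumr_const card_bool -[LHS]mulr_natr mulVf.
have pN : pr P (V @^-1` [set None]) = 0.
  by move: tot; rewrite prT split_option sumV setTI; lra.
rewrite (pr_sum_fin P mV mX) split_option.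
rewrite (_ : pr P (_ `&` V @^-1` [set None]) = 0) ?add0r; last first.
  apply/eqP; rewrite eq_le pr_ge0 andbT -pN le_pr //; exact: measurableI.
apply: eq_bigr => v _; rewrite -pr_first_runs VE; case: eqP => [E|E].
  rewrite mulr1; congr pr; apply/seteqP; split => w /=; first by case.
  by move=> h; split => //; rewrite (X_first_runs h).
rewrite mulr0 (_ : _ `&` _ = set0) ?/pr ?measure0 //.
by apply/seteqP; split => w //= [h1 h2]; apply: E; rewrite -h1 (X_first_runs h2).
Qed.

Variable Y : {RV P >-> n.-tuple bool}.
Hypothesis XY : independent_copy P X Y.

Definition law_Y (y : n.-tuple bool) : R := pr P (Y @^-1` [set y]).

Lemma measurable_fibers_Y : measurable_fibers Y.
Proof. by move=> y; apply: measurable_funPTI; apply: measurable_tuple_set1. Qed.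

Let XYfun w := (X w, Y w).

Lemma measurable_fibers_XY : measurable_fibers XYfun.
Proof.
by apply: measurable_fibers_pair; [exact: measurable_fibers_X | exact: measurable_fibers_Y].
Qed.

Lemma law_XY (F : n.-tuple bool -> n.-tuple bool -> R) :
  \sum_z F z.1 z.2 * pr P (XYfun @^-1` [set z]) =
  \sum_w mass length_law law_Y w * F (str l w.1.1 w.1.2) w.2.
Proof.
transitivity (\sum_x \sum_y F x y * pr P (XYfun @^-1` [set (x, y)])).
  by rewrite pair_bigA; apply: eq_bigr => -[].
transitivity (\sum_v \sum_y mass length_law law_Y (v, y) * F (str l v.1 v.2) y); last first.
  by rewrite pair_bigA; apply: eq_bigr => -[].
rewrite [LHS]exchange_big [RHS]exchange_big; apply: eq_bigr => y _ /=.
transitivity (\sum_x \sum_v 2^-1 * weight length_law v.2 * (str l v.1 v.2 == x)%:R *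
    (F x y * law_Y y)).
  apply: eq_bigr => x _; rewrite -mulr_suml -law_X.
  rewrite (_ : _ @^-1` _ = X @^-1` [set x] `&` Y @^-1` [set y]); last first.
    by apply/seteqP; rewrite /XYfun; split => w /= => [[-> ->]|[-> ->]].
  rewrite mulrCA; congr (_ * _); rewrite /pr XY.2 ?fineM ?fin_num_measure //.
  - exact: measurable_fibers_X.
  - exact: measurable_fibers_Y.
  - exact: measurable_tuple_set1.
  - exact: measurable_tuple_set1.
rewrite exchange_big; apply: eq_bigr => v _.
rewrite (bigD1 (str l v.1 v.2)) //= eqxx big1 ?addr0.
  by rewrite /mass /=; ring.
by move=> x /negbTE; rewrite eq_sym => ->; rewrite mulr0 mul0r.
Qed.

Lemma law_Y_ge0 y : 0 <= law_Y y.
Proof. exact: pr_ge0. Qed.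

Lemma sum_law_Y : \sum_y law_Y y = 1.
Proof.
have := pr_sum_fin P measurable_fibers_Y measurableT; rewrite prT => ->.
by apply: eq_bigr => y _; rewrite setTI.
Qed.

Variables I J : {RV P >-> nat}.
Hypothesis IJ : uniform_block_choice l X Y I J.

(** On the event (X, Y) = (x, y) the chosen pair is almost surely a short-long pair of x,
    because the probabilities of these pairs already add up to that of the event. *)
Lemma mean_block_choice (g : nat -> nat -> R) (x y : n.-tuple bool) :
  has_both_blocks l x ->
  fine (\int[P]_(w in XYfun @^-1` [set (x, y)]) (g (I w) (J w))%:E) =
  pr P (XYfun @^-1` [set (x, y)]) *
  (((size (blocks l.-1 x))%:R^-1 * (size (blocks l.+1 x))%:R^-1) *
   \sum_(i <- blocks l.-1 x) \sum_(j <- blocks l.+1 x) g i j).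
Proof.
move=> /andP[B1 B3].
set D := XYfun @^-1` _; have mD : measurable D by apply: measurable_fibers_XY.
pose Q w := (I w, J w).
have mQ : measurable_fibers Q.
  by apply: measurable_fibers_pair => i; apply: measurable_funPTI.
pose s := [seq (i, j) | i <- blocks l.-1 x, j <- blocks l.+1 x].
have us : uniq s.
  by rewrite allpairs_uniq ?filter_uniq ?iota_uniq // => -[? ?] [? ?].
have prs k : k \in s -> pr P (D `&` Q @^-1` [set k]) =
    pr P D * ((size (blocks l.-1 x))%:R^-1 * (size (blocks l.+1 x))%:R^-1).
  move=> /allpairsP[[i j] [/= hi hj ->]].
  have := IJ y hi hj.
  rewrite (_ : [set w | _] = D `&` Q @^-1` [set (i, j)]); last first.
    apply/seteqP; rewrite /D /XYfun /Q; split => w /=; first by case=> -> -> -> ->.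
    by case=> -[-> ->] [-> ->].
  rewrite (_ : [set w | _] = D); last first.
    by apply/seteqP; rewrite /D /XYfun; split => w /=; [case=> -> -> | case=> -> ->].
  rewrite prE ?(prE P mD) -?EFinM; first by move=> [].
  by apply: measurableI.
have size_neq0 (t : seq nat) : t != [::] -> (size t)%:R != 0 :> R.
  by rewrite -size_eq0 pnatr_eq0.
have n1 := size_neq0 _ B1; have n3 := size_neq0 _ B3.
have h0 : pr P (D `&` [set w | Q w \notin s]) = 0.
  have := pr_split P mQ (mem s) mD.
  rewrite (pr_mem P mQ mD us) big_seq (eq_bigr _ prs) -big_seq big_const_seq count_predT.
  rewrite iter_addr_0 size_allpairs -[_ *+ _]mulr_natr natrM.
  rewrite (_ : pr P D * _ * _ = pr P D); first lra.
  by field; apply/andP.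
rewrite (integral_comp_count mQ (fun k : nat * nat => g k.1 k.2) mD us h0) /=.
rewrite big_seq (eq_bigr (fun k : nat * nat => pr P D * ((size (blocks l.-1 x))%:R^-1 *
   (size (blocks l.+1 x))%:R^-1) * g k.1 k.2)); last first.
  by move=> k /prs ->; rewrite mulrC.
by rewrite -big_seq -mulr_sumr big_allpairs -mulrA.
Qed.

End Law.

(** * The lower bound on the variance *)

(** Choose k with alpha k >= 2. Then exp(y) >= (1 + y / k)^k >= (y / k)^k, and for
    y = n^alpha this is at least n^2 / k^k. *)
Lemma expR_powR_bound (R : realType) (alpha : R) : 0 < alpha ->
  exists C : R, 0 < C /\ forall n : nat, (0 < n)%N ->
    expR (- (n%:R `^ alpha)) <= C / n%:R ^+ 2.
Proof.
move=> a0.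
have [k /= hk] : exists k : nat, 2 / alpha < k%:R.
  by exists (Num.bound (2 / alpha)); rewrite archi_boundP // divr_ge0 // ltW.
have k0 : 0 < k%:R :> R by apply: lt_trans hk; rewrite divr_gt0.
have k0' : (0 < k)%N by rewrite -(ltr0n R).
exists (k%:R ^+ k); split; first exact: exprn_gt0.
move=> n n0.
have n1 : 1 <= n%:R :> R by rewrite ler1n.
have y0 : 0 <= n%:R `^ alpha by apply: powR_ge0.
set y := n%:R `^ alpha in y0 *.
have n2y : n%:R ^+ 2 <= y ^+ k.
  rewrite -!powR_mulrn ?powR_ge0 ?ler0n // /y -powRrM ler_powR //.
  by rewrite mulrC -ler_pdivrMr // ltW.
have yk : (y / k%:R) ^+ k <= expR y.
  rewrite -[X in expR X](divfK (lt0r_neq0 k0)) [X in expR X]mulrC.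
  rewrite expRM_natl lerXn2r ?nnegrE ?expR_ge0 ?divr_ge0 ?ler0n //.
  by apply: le_trans (expR_ge1Dx _); rewrite lerDr.
rewrite expRN -[leRHS]invf_div lef_pV2 ?posrE ?expR_gt0 ?divr_gt0 ?exprn_gt0 ?ltr0n //.
apply: le_trans yk; rewrite expr_div_n ler_wpM2r // invr_ge0 exprn_ge0 //.
Qed.

(** Take m = (n-1) / (l+1), rounded down: with s = n / (l+1) >= 4 one has m >= s - 1,
    hence m (m - 1) >= (s - 1) (s - 2) >= s^2 / 4. *)
Lemma blocks_guaranteed (R : realType) (l n : nat) : (4 * l.+1 <= n)%N ->
  exists m, (m * l.+1 < n)%N /\
    n%:R ^+ 2 / (4 * l.+1%:R ^+ 2) <= m%:R * (m%:R - 1) :> R.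
Proof.
move=> hn; exists (n.-1 %/ l.+1)%N; set m := (_ %/ _)%N.
have m1 : (m * l.+1 <= n.-1)%N by apply: leq_trunc_div.
have m2 : (n.-1 < m.+1 * l.+1)%N by rewrite ltn_ceil.
split; first by lia.
have l0 : 0 < l.+1%:R :> R by rewrite ltr0n.
set s : R := n%:R / l.+1%:R.
have s4 : 4 <= s by rewrite ler_pdivlMr // -natrM ler_nat.
have sm : s <= m%:R + 1 by rewrite ler_pdivrMr // natr1 -natrM ler_nat; lia.
rewrite (_ : _ / _ = s ^+ 2 / 4); last by rewrite /s; field; rewrite lt0r_neq0.
nra.
Qed.

Lemma lcs_le (x y : seq bool) : (lcs x y <= size x)%N.
Proof. by apply/bigmax_leqP => k _; rewrite -ltnS. Qed.

Theorem theorem4p1 (R : realType) (d : measure_display) (T : measurableType d)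
  (P : probability T R)
  (l : nat) (q1 q2 q3 : R)
  (th : {RV P >-> bool}) (W : nat -> {RV P >-> nat})
  (Y : forall n : nat, {RV P >-> n.-tuple bool})
  (I J : nat -> {RV P >-> nat})
  (X : forall n : nat, T -> n.-tuple bool)
  (Z Ztilde : nat -> T -> seq bool * seq bool)
  (L : seq bool * seq bool -> R)
  (l_ge2 : (2 <= l)%N)
  (q1_01 : 0 < q1 < 1) (q2_01 : 0 < q2 < 1) (q3_01 : 0 < q3 < 1)
  (q_sum : q1 + q2 + q3 = 1)
  (model : multinomial_blocks l q1 q2 q3 th W)
  (X_def : forall n w, X n w = run_string (th w) (fun k => W k w) n)
  (Y_copy : forall n, independent_copy P (X n) (Y n))
  (Z_def : forall n w, Z n w = (tval (X n w), tval (Y n w)))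
  (choice_unif : forall n, uniform_block_choice l (X n) (Y n) (I n) (J n))
  (Ztilde_def : forall n w,
     Ztilde n w = (block_transform l (X n w) (I n w) (J n w), tval (Y n w)))
  (L_def : forall z, L z = (lcs z.1 z.2)%:R) :
  (exists alpha eps0 : R, [/\ 0 < alpha, 0 < eps0 &
    \forall n \near \oo,
      ((1 - expR (- (n%:R `^ alpha)))%:E <=
       P [set w | (eps0 <=
          cond_expectation P (fun v => L (Ztilde n v) - L (Z n v)) (Z n) w)%R])%E]) ->
  exists b : R, 0 < b /\ exists n6 : nat, forall n : nat, (n6 < n)%N ->
    ((b * n%:R)%:E <= 'V_P[fun w => L (Z n w)])%E.
Proof.
case=> alpha [eps [alpha0 eps0 [N _ HN]]].
have {q1_01} q1_0 : 0 < q1 by case/andP: q1_01.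
have {q2_01} q2_0 : 0 < q2 by case/andP: q2_01.
have {q3_01} q3_0 : 0 < q3 by case/andP: q3_01.
pose q := length_law q1 q2 q3.
have q_ge0 a : 0 <= q a.
  by case: a => -[|[|[|//]]] i; rewrite /q /length_law /=; apply: ltW.
have q_tot : \sum_a q a = 1.
  by rewrite !big_ord_recl big_ord0 /q /length_law /= addr0 addrA.
have [C [C0 hC]] := @expR_powR_bound R alpha alpha0.
(* c0 n^2 bounds eps E[N1 N3] from below, and c1 n^2 bounds E[S L(Z)]. *)
pose c0 : R := eps * (q1 * q3) / (4 * l.+1%:R ^+ 2).
have c0_0 : 0 < c0 by rewrite divr_gt0 ?mulr_gt0 ?exprn_gt0 ?ltr0n.
pose c1 : R := q2 ^+ 2 * (c0 / 2).
have c1_0 : 0 < c1.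
  by apply: mulr_gt0; [exact: exprn_gt0 | exact: divr_gt0].
exists (c1 ^+ 2 / 8); split; first by rewrite divr_gt0 ?exprn_gt0.
have [M hM] : exists M : nat, 2 * (eps + 1) * C / c0 < M%:R.
  exists (Num.bound (2 * (eps + 1) * C / c0)).
  by apply/archi_boundP/ltW; rewrite divr_gt0 ?mulr_gt0 ?addr_gt0.
exists (N + M + 4 * l.+1)%N => n hn.
have Nn : (N <= n)%N.
  exact: leq_trans (leq_trans (leq_addr _ _) (leq_addr _ _)) (ltnW hn).
have Mn : (M <= n)%N.
  exact: leq_trans (leq_trans (leq_addl _ _) (leq_addr _ _)) (ltnW hn).
have n0 : (0 < n)%N by apply: leq_ltn_trans hn.
have [m [mn hm]] := @blocks_guaranteed R l n ltac:(lia).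
pose delta := expR (- (n%:R `^ alpha)) : R.
pose f (x : seq bool) (y : n.-tuple bool) : R := (lcs x y)%:R.
pose Q w := (X n w, Y n w).
have mQ : measurable_fibers Q.
  exact: (measurable_fibers_XY (X_def n)).
have [c ->] : exists c, ('V_P[fun w => L (Z n w)] =
    (\sum_(z : n.-tuple bool * n.-tuple bool) (f z.1 z.2 - c) ^+ 2 * pr P (Q @^-1` [set z]))%:E)%E.
  have [c Hc] := @variance_fin _ _ _ P _ Q (fun z => f z.1 z.2) mQ.
  exists c; rewrite -Hc; congr ('V_P[_])%E.
  by apply/funext => w; rewrite L_def Z_def.
rewrite lee_fin.
have LXY := law_XY l_ge2 model q_tot (X_def n) (Y_copy n).
rewrite (LXY (fun x y => (f x y - c) ^+ 2)).
pose n13 (x : seq bool) : R := (size (blocks l.-1 x))%:R * (size (blocks l.+1 x))%:R.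
pose bad (x y : n.-tuple bool) := ~~ (eps * n13 x <= drift l f x y).
(* On an atom of positive mass the conditional mean is drift / (N1 N3), so a small
   drift puts the whole atom in the exceptional event of the hypothesis. *)
have hdelta : \sum_w mass q (law_Y (Y n)) w * (bad (str l w.1.1 w.1.2) w.2)%:R <= delta.
  rewrite -(LXY (fun x y => (bad x y)%:R)).
  pose H w := cond_expectation P (fun v => L (Ztilde n v) - L (Z n v)) (Z n) w.
  pose h (z : n.-tuple bool * n.-tuple bool) : R :=
    fine (\int[P]_(v in Q @^-1` [set z]) (L (Ztilde n v) - L (Z n v))%:E) /
    fine (P (Q @^-1` [set z])).
  have Hh w : H w = h (Q w).
    rewrite /H /cond_expectation /h.
    rewrite (_ : Z n @^-1` [set Z n w] = Q @^-1` [set Q w]) //.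
    apply/seteqP; split => v /=; rewrite !Z_def /Q.
      by case=> /val_inj -> /val_inj ->.
    by case=> -> ->.
  have mG : measurable [set w | eps <= h (Q w)].
    exact: (measurable_preimage_count [set z | eps <= h z]).
  have mB : measurable [set w | ~~ (eps <= h (Q w))].
    exact: (measurable_preimage_count [set z | ~~ (eps <= h z)]).
  have := HN n Nn.
  rewrite (_ : [set w | _] = [set w | eps <= h (Q w)]); last first.
    by apply/seteqP; split => w /=; rewrite -Hh.
  rewrite (prE P mG) lee_fin -/delta => Hdelta.
  apply: (@le_trans _ _ (pr P [set w | ~~ (eps <= h (Q w))])); last first.
    have := pr_split P mQ [pred z | eps <= h z] measurableT.
    by rewrite prT !setTI /=; lra.
  rewrite (pr_sum_fin P mQ mB); apply: ler_sum => -[x y] _ /=.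
  set A := Q @^-1` [set (x, y)].
  have mA : measurable A by apply: mQ.
  case: (boolP (bad x y)) => hbad; last by rewrite mul0r pr_ge0.
  rewrite mul1r.
  have [p0|p0] := eqVneq (pr P A) 0; first by rewrite p0 pr_ge0.
  rewrite le_eqVlt; apply/orP; left; apply/eqP; congr pr.
  apply/seteqP; split => w /=; last by case.
  move=> Aw; split => //; rewrite (Aw : Q w = (x, y)); apply: contra hbad.
  rewrite /h -/A -/(pr P A).
  rewrite (_ : (\int[P]_(v in A) _)%E =
      \int[P]_(v in A) (f (block_transform l x (I n v) (J n v)) y - f x y)%:E)%E; last first.
    apply: eq_integral => v; rewrite inE => Av.
    rewrite !L_def Z_def Ztilde_def /=; case: Av => -> ->; done.
  (* Without both kinds of blocks the drift and the number of pairs both vanish. *)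
  have [hb|] := boolP (has_both_blocks l x); last first.
    rewrite /has_both_blocks negb_and !negbK => hb _.
    rewrite /n13 /drift; case/orP: hb => /eqP ->; first by rewrite !big_nil mul0r mulr0.
    by rewrite mulr0 mulr0 big1 // => i _; rewrite big_nil.
  have := mean_block_choice (X_def n) (choice_unif n)
    (fun i j => f (block_transform l x i j) y - f x y) y hb.
  rewrite -/A => ->; rewrite -/(drift l f x y) -/(n13 x).
  rewrite mulrAC divff // mul1r -invfM -/(n13 x) mulrC ler_pdivlMr //.
  case/andP: hb => h1 h3.
  by rewrite mulr_gt0 // ltr0n lt0n size_eq0.
have f0 x y : 0 <= f x y by rewrite /f ler0n.
have fn (x : n.-tuple bool) y : f x y <= n%:R.
  by rewrite /f ler_nat (leq_trans (lcs_le _ _)) // size_tuple.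
(* t maximises 2 t (c1 n^2) - t^2 (8 n^3). *)
pose t := c1 / (8 * n%:R).
have n0R : 0 < n%:R :> R by rewrite ltr0n.
have t0 : 0 <= t by rewrite divr_ge0 ?mulr_ge0 // ltW.
have := @finite_variance_bound R l n q l_ge2 n0 q_ge0 q_tot (law_Y (Y n))
  (@law_Y_ge0 _ _ _ _ _ _) (sum_law_Y _) f
  (fun w => bad (str l w.1.1 w.1.2) w.2) eps delta c t m (ltW eps0) t0 mn f0 fn
  (fun w => @negbNE _) hdelta.
move=> /(le_trans _); apply.
have delta_le : (eps + n%:R) * delta <= c0 / 2.
  have n1 : 1 <= n%:R :> R by rewrite ler1n.
  apply: (@le_trans _ _ ((eps + 1) * n%:R * (C / n%:R ^+ 2))).
    apply: ler_pM; rewrite ?expR_ge0 ?addr_ge0 ?(ltW eps0) //; last exact: hC.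
    by rewrite mulrDl mul1r lerD2r ler_peMr // ltW.
  rewrite (_ : _ * _ = (2 * (eps + 1) * C / c0) * (c0 / 2) / n%:R); last first.
    by field; rewrite !lt0r_neq0.
  rewrite ler_pdivrMr // mulrC; apply: ler_wpM2l; first exact: divr_ge0 (ltW c0_0) _.
  by apply: le_trans (ltW hM) _; rewrite ler_nat.
(* Half of c0 n^2 absorbs the contribution of the exceptional event. *)
have key : c1 * n%:R ^+ 2 <= q medium ^+ 2 * (eps * (q short * q long *
    (m%:R * (m%:R - 1))) - (eps + n%:R) * n%:R ^+ 2 * delta).
  rewrite /c1 -mulrA; apply: ler_wpM2l; first exact: sqr_ge0.
  rewrite (_ : q short = q1) // (_ : q long = q3) //.
  have h1 : c0 * n%:R ^+ 2 <= eps * (q1 * q3 * (m%:R * (m%:R - 1))).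
    rewrite (_ : c0 * _ = eps * (q1 * q3) * (n%:R ^+ 2 / (4 * l.+1%:R ^+ 2))).
      rewrite -mulrA; apply: ler_wpM2l; first exact: ltW.
      by apply: ler_wpM2l => //; rewrite mulr_ge0 // ltW.
    by rewrite /c0; ring.
  have h2 : (eps + n%:R) * delta * n%:R ^+ 2 <= c0 / 2 * n%:R ^+ 2.
    by rewrite ler_wpM2r // sqr_ge0.
  rewrite mulrAC; lra.
apply: (@le_trans _ _ (2 * t * (c1 * n%:R ^+ 2) - t ^+ 2 * (8 * n%:R ^+ 3))).
  rewrite (_ : _ - _ = c1 ^+ 2 / 8 * n%:R) // /t.
  by field; rewrite lt0r_neq0.
by rewrite lerB // ler_wpM2l // mulr_ge0.
Qed.
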